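(* Let $n\ge1$, $0\le m\le n-1$, and let $\tau=b_1\ldots b_n$ be a permutation of size $n$ such that $\tau=T^m(\pi)$ for some permutation $\pi$ of size $n$. Then $\max_{1\le i\le n}|b_i-i|\le n-1-m$.
   Context: Falls of a permutation are its maximal decreasing strings of consecutive entries; the flip $T$ reverses every fall of a permutation in place, and $T^m$ denotes its $m$-fold iterate ($T^0$ is the identity map). The quantity $\max_i|b_i-i|$ is the bandwidth of $\tau$. *)

(* Defs.v *)
From mathcomp Require Import all_boot all_order all_algebra all_fingroup.

Set Implicit Arguments.
Unset Strict Implicit.
Unset Printing Implicit Defensive.

(* Permutations of size n are elements of 'S_n, so both positions and values
   run over 0, ..., n - 1 instead of 1, ..., n; this leaves the flip and the
   differences b_i - i unchanged. *)

Section Falls.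

Variable n : nat.

(* The falls of a word, from left to right. That they are exactly the maximal
   decreasing strings of consecutive entries is the content of falls_neq0,
   flatten_falls, falls_decreasing and falls_maximal below. *)
Fixpoint falls (w : seq 'I_n) : seq (seq 'I_n) :=
  if w is x :: w' then
    if falls w' is (y :: f) :: fs then
      if y < x then (x :: y :: f) :: fs else [:: x] :: (y :: f) :: fs
    else [:: [:: x]]
  else [::].

Definition flip_word (w : seq 'I_n) : seq 'I_n := flatten (map rev (falls w)).

Lemma falls_neq0 w : all (fun f => f != [::]) (falls w).
Proof.
elim: w => //= x w; case: (falls w) => [|[|y f] fs] //= H.
by case: ifP.
Qed.

Lemma flatten_falls w : flatten (falls w) = w.
Proof.
elim: w => //= x w; have := falls_neq0 w.
case: (falls w) => [|[|y f] fs] //= _ <- //.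
by case: ifP.
Qed.

Lemma falls_decreasing w :
  all (sorted (fun x y : 'I_n => y < x)) (falls w).
Proof.
elim: w => //= x w; case: (falls w) => [|[|y f] fs] //= /andP[Hf Hfs].
by case: ifP => Hyx /=; rewrite ?Hyx Hf Hfs.
Qed.

Lemma falls_maximal w (x0 : 'I_n) :
  sorted (fun f g : seq 'I_n => last x0 f <= head x0 g) (falls w).
Proof.
elim: w => //= x w; case: (falls w) => [|[|y f] fs] //= H.
case: ifP => Hyx /=; first by case: fs H.
by rewrite leqNgt Hyx.
Qed.

Lemma perm_flip_word w : perm_eq (flip_word w) w.
Proof.
rewrite -[X in perm_eq _ X]flatten_falls /flip_word.
by elim: (falls w) => //= f fs IH; rewrite perm_cat // perm_rev.
Qed.

Lemma size_flip_word (s : 'S_n) :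
  size (flip_word [tuple s i | i < n]) == n.
Proof. by rewrite (perm_size (perm_flip_word _)) size_tuple. Qed.

Definition flip_fun (s : 'S_n) (i : 'I_n) : 'I_n :=
  tnth (Tuple (size_flip_word s)) i.

Lemma flip_fun_inj s : injective (flip_fun s).
Proof.
apply/tuple_uniqP; rewrite /= (perm_uniq (perm_flip_word _)).
by rewrite map_inj_uniq ?enum_uniq //; exact: perm_inj.
Qed.

Definition flip (s : 'S_n) : 'S_n := perm (@flip_fun_inj s).

Definition bandwidth (s : 'S_n) : nat := \max_(i < n) `|(s i : nat) - i|%N.

End Falls.

(* Main.v *)
Require Import Defs.
From mathcomp Require Import all_boot all_order all_algebra all_fingroup.
From mathcomp Require Import zify.

(** Fix a threshold [k] and let [h_t(i)] count the entries smaller than [k]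
    among the first [i] entries of [T^t(pi)].  A flip never decreases [h(i)],
    and it strictly increases [h(i)] at a corner: an entry [>= k] immediately
    before the cut [i] and an entry [< k] immediately after it.  Induction on
    [t] then gives [h_t(i) >= j] whenever [j <= i], [j <= k] and
    [n + 2 j <= i + k + t + 1].  At [j = k] this bounds how far the entry
    [k - 1] can lie to the right of its place, and at [j = i] how far the entry
    [k] can lie to the left of its place. *)

Lemma count_take_nseq i c (b : bool) :
  count id (take i (nseq c b)) = b * minn i c.
Proof.
have [le_ic|le_ci] := leqP i c; first by rewrite take_nseq // count_nseq.
by rewrite take_oversize ?count_nseq // size_nseq ltnW.
Qed.

(** * Heights of words and their corners *)

Section Height.

Context {n : nat}.
Implicit Types (w f : seq 'I_n) (fs : seq (seq 'I_n)) (k i : nat).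

Definition low k w : seq bool := [seq (x : nat) < k | x : 'I_n <- w].

Definition height k w i := count id (take i (low k w)).

(* The two default values make both positions lie inside the word. *)
Definition corner k w i := ~~ nth true (low k w) i && nth false (low k w) i.+1.

Lemma size_low k w : size (low k w) = size w.
Proof. exact: size_map. Qed.

Lemma corner_nil k i : corner k [::] i = false.
Proof. by rewrite /corner nth_nil. Qed.

Lemma heightS k w i : height k w i.+1 = height k w i + nth false (low k w) i.
Proof.
rewrite /height; have [lt_i|ge_i] := ltnP i (size (low k w)).
  by rewrite (take_nth false) // -cats1 count_cat /= addn0.
by rewrite !take_oversize ?nth_default ?addn0 // ltnW.
Qed.

Lemma height_cat k w1 w2 i :
  height k (w1 ++ w2) i =
  if i < size w1 then height k w1 i
  else height k w1 (size w1) + height k w2 (i - size w1).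
Proof.
rewrite /height /low map_cat take_cat size_map.
by case: ifP => // _; rewrite count_cat (@take_oversize _ (size w1)) ?size_map.
Qed.

Lemma height_size_rev k w : height k (rev w) (size w) = height k w (size w).
Proof.
by rewrite /height /low !take_oversize ?size_map ?size_rev // map_rev count_rev.
Qed.

(** * Effect of a flip on heights *)

Lemma low_decreasing k f : sorted (fun x y : 'I_n => y < x) f ->
  exists a b, low k f = nseq a false ++ nseq b true.
Proof.
have gtn_tr : transitive (fun x y : 'I_n => y < x).
  by move=> y x z yx zy; apply: ltn_trans zy yx.
elim: f => [|x f IH] /= sxf; first by exists 0, 0.
have [a [b e]] := IH (path_sorted sxf).
rewrite -/(low k f); case: (ltnP x k) => xk; last by exists a.+1, b; rewrite e.
exists 0, (size f).+1 => /=; congr cons.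
have /allP lt_fx := order_path_min gtn_tr sxf.
rewrite -(size_low k f); apply/all_pred1P/allP => z.
by case/mapP => y /lt_fx yx ->; rewrite /= (ltn_trans yx xk).
Qed.

(** Reversing a fall moves its block of low entries to the front, where every prefix count is
    largest. *)
Lemma height_rev k f i : sorted (fun x y : 'I_n => y < x) f -> i <= size f ->
  height k f i <= height k (rev f) i.
Proof.
move=> /(low_decreasing k) [a [b e]]; rewrite -(size_low k f).
rewrite /height /low map_rev -/(low k f) e size_cat !size_nseq rev_cat !rev_nseq.
rewrite !take_cat !size_nseq !(fun_if (count id)) !count_cat.
by rewrite !count_take_nseq !count_nseq /=; do 2 case: ifP; lia.
Qed.

(** A corner forces [a = i.+1] and [b > 0]: the cut separates the two blocks, so the height there is
    0 before reversal and positive after it. *)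
Lemma height_rev_corner k f i : sorted (fun x y : 'I_n => y < x) f ->
  corner k f i -> height k f i.+1 < height k (rev f) i.+1.
Proof.
move=> /(low_decreasing k) [a [b e]].
rewrite /corner /height /low map_rev -/(low k f) e rev_cat !rev_nseq.
rewrite !nth_cat !take_cat !size_nseq !(fun_if (count id)) !count_cat !nth_nseq.
by rewrite !count_take_nseq !count_nseq /=; do ! case: ifP; lia.
Qed.

Lemma height_flatten_rev k fs i :
  all (sorted (fun x y : 'I_n => y < x)) fs ->
  height k (flatten fs) i <= height k (flatten (map rev fs)) i.
Proof.
elim: fs i => [|f fs IH] i //= /andP[sf sfs].
rewrite !height_cat size_rev; case: ltnP => lt_i.
  exact: height_rev (ltnW lt_i).
by rewrite height_size_rev leq_add2l IH.
Qed.

(** A corner is a descent, so maximality of the falls puts it inside a single fall, where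
    [height_rev_corner] applies. *)
Lemma height_flatten_rev_corner (x0 : 'I_n) k fs i :
  all (fun f => f != [::]) fs ->
  all (sorted (fun x y : 'I_n => y < x)) fs ->
  sorted (fun f g : seq 'I_n => last x0 f <= head x0 g) fs ->
  corner k (flatten fs) i ->
  height k (flatten fs) i.+1 < height k (flatten (map rev fs)) i.+1.
Proof.
elim: fs i => [|f fs IH] i; first by rewrite corner_nil.
move=> /= /andP[f0 fs0] /andP[sf sfs] max_fs.
rewrite /corner /low map_cat !nth_cat size_map -!/(low _ _) !height_cat size_rev.
have [lt_if|gt_if|eq_if] := ltngtP i.+1 (size f).
- exact: height_rev_corner sf.
- rewrite height_size_rev ltn_add2l subSn //.
  by apply: IH => //; apply: path_sorted max_fs.
(* The cut falls between two falls: the last entry of [f] would be at least [k], yet at most the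
   next entry, which is below [k]. *)
- rewrite -eq_if subnn => /andP[].
  case: fs fs0 max_fs {IH sfs} => [|[|y g] fs] //= _ /andP[le_last _].
  rewrite (nth_map x0) -?eq_if // => ge_last lt_y.
  by move: le_last ge_last; rewrite -nth_last -eq_if /=; lia.
Qed.

Lemma height_flip_word k w i : height k w i <= height k (flip_word w) i.
Proof.
by rewrite -{1}(flatten_falls w); apply: height_flatten_rev (falls_decreasing w).
Qed.

Lemma height_flip_word_corner k w i : corner k w i ->
  height k w i.+1 < height k (flip_word w) i.+1.
Proof.
case: w => [|x0 w]; first by rewrite corner_nil.
rewrite -{1 2}(flatten_falls (x0 :: w)); apply: (@height_flatten_rev_corner x0).
- exact: falls_neq0.
- exact: falls_decreasing.
- exact: falls_maximal.
Qed.

(** * Extreme heights and the lower bound after [t] flips *)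

Lemma height_le k w i j : height k w (i + j) <= height k w i + j.
Proof.
elim: j => [|j IH]; first by rewrite !addn0.
rewrite addnS heightS; move: (nth _ _ _) => [] /=; lia.
Qed.

Lemma height_leq k w i : height k w i <= i.
Proof. by have := height_le k w 0 i; rewrite /height take0. Qed.

Lemma height_all k w i : height k w i = i -> forall p, p < i -> nth false (low k w) p.
Proof.
move=> e p lt_pi; have := height_le k w p.+1 (i - p.+1).
rewrite subnKC // e heightS; have := height_leq k w p.
by case: (nth _ _ _) => /=; lia.
Qed.

Lemma height_mono k w i j : i <= j -> height k w i <= height k w j.
Proof.
by move=> /subnK <-; elim: (j - i) => // c IH; rewrite addSn heightS; lia.
Qed.

Lemma height_total k w p i : i <= p < size w ->
  height k w (size w) <= height k w i -> ~~ nth false (low k w) p.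
Proof.
move=> /andP[le_ip lt_p] le_h; have := height_mono k w _ _ le_ip.
have := height_mono k w _ _ lt_p; rewrite heightS.
by case: (nth _ _ _) => //=; lia.
Qed.

Lemma height_permutation k w : perm_eq w (enum 'I_n) -> k <= n ->
  height k w (size w) = k.
Proof.
move=> pw le_kn; rewrite /height take_oversize ?size_low // /low count_map.
rewrite (seq.permP pw) -(count_map val (fun x => x < k)) val_enum_ord.
rewrite -(subnKC le_kn) iotaD count_cat add0n.
have /eqP -> : count (fun x => x < k) (iota 0 k) == k.
  by rewrite -[X in _ == X](size_iota 0 k) -all_count; apply/allP=> x; rewrite mem_iota.
apply/eqP; rewrite -[X in _ == X]addn0 eqn_add2l -leqn0 leqNgt -has_count.
by apply/hasPn => x; rewrite mem_iota -leqNgt => /andP[].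
Qed.

Lemma height_iter_flip_word k w t i j :
  perm_eq w (enum 'I_n) -> k <= n -> i <= n -> j <= i -> j <= k ->
  n + 2 * j <= i + k + t + 1 -> j <= height k (iter t (@flip_word n) w) i.
Proof.
move=> pw le_kn; have pwt s : perm_eq (iter s (@flip_word n) w) (enum 'I_n).
  by elim: s => //= s IH; apply: perm_trans (perm_flip_word _) IH.
have sz s : size (iter s (@flip_word n) w) = n.
  by rewrite (perm_size (pwt s)) size_enum_ord.
have hn s : height k (iter s (@flip_word n) w) n = k.
  by rewrite -[RHS](height_permutation k _ (pwt s) le_kn) sz.
elim: t i j => [|t IH] i j le_in le_ji le_jk le_n.
  (* At most [n - i] of the [k] low entries lie after the cut. *)
  by have := height_le k w i (n - i); have /= := hn 0; rewrite subnKC // => ->; lia.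
case: j le_ji le_jk le_n => // j; case: i le_in => // i lt_in le_ji lt_jk le_n.
(* Otherwise the cut [i.+2] is still at most [n]. *)
have [->|ne_in] := eqVneq i.+1 n; first by rewrite hn.
rewrite iterS; set u := iter t _ w.
(* For [(i, j)] and [(i.+2, j.+1)] at time [t], the numerical condition is the one given for
   [(i.+1, j.+1)] at time [t.+1]. *)
have h0 : j <= height k u i by apply: IH; lia.
have h2 : j < height k u i.+2 by apply: IH; lia.
have [gt_j|le_j] := ltnP j (height k u i.+1).
  exact: leq_trans gt_j (height_flip_word _ _ _).
(* Here the heights at [i], [i.+1], [i.+2] must be [j], [j], [j.+1], which is a corner. *)
have := heightS k u i; have := heightS k u i.+1.
case e2 : (nth false (low k u) i.+1); last by lia.
case e1 : (nth false (low k u) i); first by lia.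
move=> _ eh; apply: leq_trans (height_flip_word_corner k u i _); first by lia.
by rewrite /corner e2 (set_nth_default false) ?e1 // size_low sz; lia.
Qed.

End Height.

(** * From words to permutations, and the bandwidth bound *)

Definition word {n : nat} (s : 'S_n) : seq 'I_n := [tuple s i | i < n].

Lemma size_word n (s : 'S_n) : size (word s) = n.
Proof. exact: size_tuple. Qed.

Lemma nth_low_word n (s : 'S_n) k (i : 'I_n) :
  nth false (low k (word s)) i = (s i < k).
Proof.
rewrite (nth_map i) ?size_word //.
by rewrite -(tnth_nth i [tuple s i | i < n] i) tnth_mktuple.
Qed.

Lemma perm_word n (s : 'S_n) : perm_eq (word s) (enum 'I_n).
Proof.
apply: uniq_perm; rewrite ?enum_uniq //.
  by rewrite map_inj_uniq ?enum_uniq //; apply: perm_inj.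
move=> x; rewrite mem_enum; apply/mapP.
by exists ((s^-1)%g x); rewrite ?mem_enum ?permKV.
Qed.

Lemma word_flip n (s : 'S_n) : word (flip s) = flip_word (word s).
Proof.
rewrite -[RHS]/(val (Tuple (size_flip_word s))); congr val.
by apply: eq_from_tnth => i; rewrite tnth_mktuple permE.
Qed.

Lemma word_iter_flip n (s : 'S_n) t :
  word (iter t (@flip n) s) = iter t (@flip_word n) (word s).
Proof. by elim: t => //= t <-; rewrite word_flip. Qed.

Theorem theorem21 (n m : nat) (tau : 'S_n) :
  1 <= n -> m <= n - 1 ->
  (exists pi : 'S_n, tau = iter m (@flip n) pi) ->
  bandwidth tau <= n - 1 - m.
Proof.
move=> n_gt0 le_mn [pi tauE]; apply/bigmax_leqP => i _.
have height_tau k p j : k <= n -> p <= n -> j <= p -> j <= k ->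
    n + 2 * j <= p + k + m + 1 -> j <= height k (word tau) p.
  rewrite tauE word_iter_flip; apply: height_iter_flip_word; exact: perm_word.
have lt_tau := ltn_ord (tau i); have lt_i := ltn_ord i.
(* Otherwise, with threshold [(tau i).+1], all low entries precede position [i], although [tau i]
   itself is low. *)
have right : i <= tau i + (n - 1 - m).
  rewrite leqNgt; apply/negP => lt_tau_i.
  have := @height_total n (tau i).+1 (word tau) i i.
  rewrite height_permutation ?perm_word // size_word leqnn lt_i nth_low_word ltnSn.
  by move/(_ isT) => absurd; suff: false by []; apply: absurd; apply: height_tau; lia.
(* Otherwise, with threshold [tau i], the first [i.+1] entries are all low, although [tau i] is
   among them. *)
have left : tau i <= i + (n - 1 - m).
  rewrite leqNgt; apply/negP => lt_i_tau.
  have := @height_all n (tau i) (word tau) i.+1 _ i (ltnSn i).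
  rewrite nth_low_word ltnn => absurd; suff: false by [].
  apply: absurd; apply/eqP; rewrite eqn_leq height_leq /=.
  by apply: height_tau; lia.
lia.
Qed.
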